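(* Let $K=\mathbb{R}$ or $\mathbb{C}$, and let $T$ be the Takasaki quandle of the abelian group $H=\mathbb{Z}_{n_1}\times\mathbb{Z}_{n_2}\times\cdots\times\mathbb{Z}_{n_k}$, where $\gcd(n_i,2)=1$ for all $1\le i\le k$. Then the quandle ring $K[T]$ decomposes as a direct sum of simple right ideals $$K[T]=V_{triv}\oplus\bigoplus_{j=1}^{(|H|-1)/2}V_j,$$ where $V_{triv}$ is the one-dimensional subspace spanned by $\sum_{x\in T}x$ and, for each $1\le j\le (|H|-1)/2$, $V_j$ is a simple right ideal which, as a representation of $\mathrm{Inn}(T)$, is equivalent to $\psi_j$. Here $\{\psi_j : 1\le j\le (|H|-1)/2\}$ is a complete set of pairwise inequivalent irreducible degree-two representations over $K$ of $\mathrm{Inn}(T)\cong \mathrm{Dih}(H)$.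
   Context: The Takasaki quandle of a finite additive abelian group $H$ is the set $T=H$ with operation $a\triangleright b=2b-a$. For $x\in T$ the right multiplication map is $R_x:T\to T$, $R_x(y)=y\triangleright x$; $\mathrm{Inn}(T)$ is the group of permutations of $T$ generated by all $R_x$, $x\in T$. The quandle ring $K[T]$ is the $K$-vector space with basis $T$ and the (in general non-associative) bilinear multiplication extending $\triangleright$. A right ideal of $K[T]$ is a $K$-subspace $I$ with $I\cdot K[T]\subseteq I$; it is simple if it is nonzero and contains no right ideals of $K[T]$ other than $0$ and itself. $\mathrm{Inn}(T)$ acts linearly on $K[T]$ by the representation $\rho_T$ with $\rho_T(R_x)(y)=y\triangleright x$ for $x,y\in T$; right ideals are exactly the $\mathrm{Inn}(T)$-invariant subspaces. $\mathrm{Dih}(H)=H\rtimes\mathbb{Z}_2=\langle H,s\mid s^2=1,\ shs^{-1}=h^{-1}\ (h\in H)\rangle$ is the generalised dihedral group. $\mathrm{Inn}(T)$ is identified with $\mathrm{Dih}(H)$ by letting the abelian group generated by the maps $R_{e_i}R_{e_0}$ ($1\le i\le k$) correspond to $H$ and $R_{e_0}$ correspond to $s$, where $e_0=(0,\dots,0)$ and $e_i$ has $i$-th coordinate $1$ and all other coordinates $0$.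
   Formalization: The isomorphism Inn(T) ≅ Dih(H) is stated only for |H| > 1, since for trivial H (all n_i = 1) Inn(T) is trivial while Dih(H) = Z_2; the rest of the theorem is stated for all H. *)

(* Defs.v *)
From HB Require Import structures.
From mathcomp Require Import all_boot all_order all_algebra all_fingroup.
From mathcomp Require Import mxrepresentation.
From mathcomp Require Import complex reals.

Set Implicit Arguments.
Unset Strict Implicit.
Unset Printing Implicit Defensive.

Import GRing.Theory.
Local Open Scope ring_scope.

(* [K[T]]; [K^o] is [K] seen as a vector space over itself. *)
Notation quandle_ring K T := {ffun T -> K^o}.

Section QuandleRing.
Variables (K : fieldType) (T : finType) (op : T -> T -> T).

Definition qbasis (x : T) : quandle_ring K T := [ffun y => (y == x)%:R].

Definition qmul (u v : quandle_ring K T) : quandle_ring K T :=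
  \sum_(x : T) \sum_(y : T) (u x * v y) *: qbasis (op x y).

Definition right_ideal (I : {vspace quandle_ring K T}) : Prop :=
  forall u v : quandle_ring K T, u \in I -> qmul u v \in I.

Definition simple_right_ideal (I : {vspace quandle_ring K T}) : Prop :=
  [/\ right_ideal I, I != 0%VS &
      forall J : {vspace quandle_ring K T},
        right_ideal J -> (J <= I)%VS -> J = 0%VS \/ J = I].

(* The linear action on [K[T]] of a permutation [g] of [T]: [y |-> g y] on
   the basis. *)
Definition perm_action (g : {perm T}) (u : quandle_ring K T) :
    quandle_ring K T :=
  \sum_(y : T) u y *: qbasis (g y).

(* [V], with this action of [G], is equivalent to the representation [rG].
   Permutations compose left to right in the library, [(g * h) y = h (g y)],
   and representations act on row vectors from the right, so that both sides
   below are actions for the same product. *)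
Definition equivalent_to_repr (G : {group {perm T}}) (d : nat)
    (V : {vspace quandle_ring K T}) (rG : mx_representation K G d) : Prop :=
  exists f : 'Hom('rV[K]_d, quandle_ring K T),
    [/\ lker f = 0%VS, limg f = V &
        forall g, g \in G -> forall v, f (v *m rG g) = perm_action g (f v)].

End QuandleRing.

Definition complete_irr_family (K : fieldType) (gT : finGroupType)
    (G : {group gT}) (d m : nat) (psi : 'I_m -> mx_representation K G d) :
    Prop :=
  [/\ forall j, mx_irreducible (psi j),
      forall i j, mx_rsim (psi i) (psi j) -> i = j &
      forall rG : mx_representation K G d,
        mx_irreducible rG -> exists j, mx_rsim rG (psi j)].

Section Takasaki.
Variable H : finZmodType.

Definition takasaki (a b : H) : H := b *+ 2 - a.

Lemma takasaki_inj (x : H) : injective (takasaki^~ x).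
Proof. by move=> y z /addrI /oppr_inj. Qed.

Definition rmult (x : H) : {perm H} := perm (@takasaki_inj x).

Definition Inn : {group {perm H}} := <<[set rmult x | x : H]>>%G.

End Takasaki.

(* The pair [(h, b)] stands for [h s^b]. *)
Definition gdihedral (H : finZmodType) : Type := (H * bool)%type.

HB.instance Definition _ (H : finZmodType) :=
  Finite.copy (gdihedral H) (H * bool)%type.

Section Dihedral.
Variable H : finZmodType.
Implicit Types x y : gdihedral H.

Definition dih_mul x y : gdihedral H :=
  (x.1 + (if x.2 then - y.1 else y.1), x.2 (+) y.2).
Definition dih_one : gdihedral H := (0, false).
Definition dih_inv x : gdihedral H := (if x.2 then x.1 else - x.1, x.2).

Lemma dih_mulA : associative dih_mul.
Proof.
move=> [a [|]] [b [|]] [c [|]]; rewrite /dih_mul /=;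
  by rewrite ?opprD ?opprK ?addrA.
Qed.

Lemma dih_mul1 : left_id dih_one dih_mul.
Proof. by move=> [a b]; rewrite /dih_mul /= add0r. Qed.

Lemma dih_mulV : left_inverse dih_one dih_inv dih_mul.
Proof.
by move=> [a [|]]; rewrite /dih_mul /dih_one /dih_inv /= ?subrr ?addNr.
Qed.

HB.instance Definition _ :=
  Finite_isGroup.Build (gdihedral H) dih_mulA dih_mul1 dih_mulV.

Definition dih_rot (h : H) : gdihedral H := (h, false).
Definition dih_s : gdihedral H := (0, true).

End Dihedral.

(* [Z_m] for [m > 0].  The library's ['Z_m] is not used because ['Z_1] has two
   elements. *)
Notation Zmod m := 'I_(m.-1.+1).

Definition prodZ (k : nat) (n : 'I_k -> nat) : Type :=
  {dffun forall i : 'I_k, Zmod (n i)}.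

Section ProdZ.
Variables (k : nat) (n : 'I_k -> nat).

HB.instance Definition _ :=
  Finite.copy (prodZ n) {dffun forall i : 'I_k, Zmod (n i)}.

Implicit Types a b : prodZ n.

Definition prodZ_add a b : prodZ n := [ffun i => a i + b i].
Definition prodZ_zero : prodZ n := [ffun i => 0].
Definition prodZ_opp a : prodZ n := [ffun i => - a i].

Lemma prodZ_addA : associative prodZ_add.
Proof. by move=> a b c; apply/ffunP => i; rewrite !ffunE addrA. Qed.

Lemma prodZ_addC : commutative prodZ_add.
Proof. by move=> a b; apply/ffunP => i; rewrite !ffunE addrC. Qed.

Lemma prodZ_add0 : left_id prodZ_zero prodZ_add.
Proof. by move=> a; apply/ffunP => i; rewrite !ffunE add0r. Qed.

Lemma prodZ_addN : left_inverse prodZ_zero prodZ_opp prodZ_add.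
Proof. by move=> a; apply/ffunP => i; rewrite !ffunE addNr. Qed.

HB.instance Definition _ := GRing.isZmodule.Build (prodZ n)
  prodZ_addA prodZ_addC prodZ_add0 prodZ_addN.

Definition prodZ_e (i : 'I_k) : prodZ n :=
  [ffun j => if j == i then inZp 1 else 0].

End ProdZ.

(* Main.v *)
From HB Require Import structures.
Require Import Defs.
From mathcomp Require Import all_boot all_order all_algebra all_fingroup.
From mathcomp Require Import cyclic mxrepresentation separable cyclotomic.
From mathcomp Require Import complex reals ring.

Set Implicit Arguments.
Unset Strict Implicit.
Unset Printing Implicit Defensive.

Import Order.TTheory GRing.Theory Num.Theory.
Local Open Scope ring_scope.

(** Every construction rests on the vectors
    u_a(x) = (cos <a, x>, sin <a, x>) of the plane K^2, where a and x range
    over H and <a, x> is the angle of a symmetric nondegenerate pairing of H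
    with the unit circle. For fixed a they are the vertices of a regular
    polygon (possibly with repetitions), and the quandle operation becomes a
    reflection of the polygon: u_a(2x - y) is the mirror image of u_a(y) in
    the line through u_a(x) ([vertex_reflection]). Hence Inn(T) acts on the
    polygon by orthogonal matrices, which for a <> 0 gives a degree-two
    representation psi_a ([psi]). Only the real and imaginary parts of the
    characters of H enter, so a single argument covers the real and the
    complex field.

    Three averaging identities do the rest. For a <> 0, the sum over x of
    u_a(x)^T u_a(x) is a nonzero scalar matrix ([vertex_frame]), so a vector
    orthogonal to all vertices vanishes: this makes the matrix inducing a
    given g unique and computable ([polygon_mx]), and psi_a irreducible
    ([psi_irr]), because w psi_a(R_x) + w is a multiple of u_a(x), so that an
    invariant subspace contains a vertex, then all of them. The sum over x of
    cos <a, x> cos <b, x> vanishes unless b = a or b = - a ([tcos_orth]),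
    whence the traces tell psi_a and psi_b apart ([psi_inj]). Finally the sum
    over a of u_a(x) . u_a(y) is |H| if x = y and 0 otherwise
    ([vertex_inversion]). This Fourier inversion is used twice.

    It shows that every basis element of K[T] is a combination of the
    functions y |-> v . u_a(y), so that these spaces V_a, each a copy of
    psi_a for a <> 0, span K[T] together with the constants. One element a is
    kept from each pair {a, - a}; dimensions add up to |H|, so the sum is
    direct ([Vcomp_direct]).

    It also shows that the list is complete ([psi_complete]). An irreducible
    representation rho of degree two contains a nonzero vector fixed by R_0,
    whose translates form a nonzero equivariant family w of vectors indexed
    by T. The matrix X_a, the sum over x of u_a(x)^T w(x), intertwines psi_a
    and rho. If X_a were zero for every a <> 0, inversion would make w
    constant, and its value would span an invariant line. *)

(** * Finite abelian groups of odd order *)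

Section OddGroup.
Variable H : finZmodType.
Hypothesis oddH : odd #|H|.
Implicit Types x y : H.

Lemma mulrn_card x : x *+ #|H| = 0.
Proof.
rewrite -FinRing.zmodXgE; apply/eqP.
by rewrite -order_dvdn -cardsT (@order_dvdG _ [set: H]%G) ?inE.
Qed.

Definition halve x : H := x *+ uphalf #|H|.

Lemma halveK x : halve x *+ 2 = x.
Proof.
rewrite /halve -mulrnA muln2 uphalfE halfK /= oddH subn0.
by rewrite mulrS mulrn_card addr0.
Qed.

Lemma mulr2n_inj x y : x *+ 2 = y *+ 2 -> x = y.
Proof.
by move=> eq2; rewrite -(halveK x) -(halveK y) /halve mulrnAC eq2 mulrnAC.
Qed.

Lemma mulr2n_eq0 x : (x *+ 2 == 0) = (x == 0).
Proof.
apply/eqP/eqP => [|->]; last by rewrite mul0rn.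
by rewrite -[RHS](mul0rn H 2); apply: mulr2n_inj.
Qed.

Lemma eq_opp0 x : (x == - x) = (x == 0).
Proof. by rewrite -mulr2n_eq0 mulr2n addr_eq0. Qed.

(** The indices of the simple components: in odd order, negation has no
    fixed point besides 0, so the nonzero elements split into pairs
    {a, - a}. *)
Lemma half_system :
  exists A : 'I_((#|H| - 1) %/ 2) -> H,
    [/\ forall j, A j != 0,
        forall i j, A i = A j \/ A i = - A j -> i = j &
        forall a, a != 0 -> exists j, a = A j \/ a = - A j].
Proof.
(* Of the two elements of a pair, the one enumerated first is kept. *)
pose lt x y := (enum_rank x < enum_rank y)%N.
pose S := [set a : H | lt a (- a)].
have nS a : (- a \in S) = (a != 0) && (a \notin S).
  rewrite !inE opprK /lt -leqNgt ltn_neqAle andbC; case: leqP => //= _.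
    by rewrite val_eqE (inj_eq enum_rank_inj) andbT -eq_opp0 eq_sym.
  by rewrite andbF.
have S0 : 0 \notin S by rewrite inE oppr0 /lt ltnn.
have cardS : #|S| = ((#|H| - 1) %/ 2)%N.
  have <- : (#|S| + #|S|)%N = (#|H| - 1)%N; last by rewrite addnn -muln2 mulnK.
  pose S' := [set - x | x in S].
  have inS' a : (a \in S') = (a != 0) && (a \notin S).
    rewrite -nS; apply/imsetP/idP => [[b Sb ->]|Sa]; first by rewrite opprK.
    by exists (- a); rewrite ?opprK.
  rewrite -{2}(card_imset S (@oppr_inj H)) -/S' subn1.
  rewrite -(cardsC1 (0 : H)) -cardsUI (_ : S :&: S' = set0).
    rewrite cards0 addn0; apply: eq_card => a; rewrite !in_setU inS' in_setC1.
    by case: eqVneq => [->|_] /=; rewrite ?(negPf S0) ?orbN.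
  by apply/setP=> a; rewrite in_setI inS' in_set0 andbCA andbN andbF.
exists (fun j => enum_val (cast_ord (esym cardS) j)); split.
- move=> j; have := enum_valP (cast_ord (esym cardS) j).
  by apply: contraTneq => ->.
- move=> i j [/enum_val_inj/cast_ord_inj//|ij].
  have := enum_valP (cast_ord (esym cardS) i).
  by rewrite ij nS enum_valP andbF.
- move=> a a0; case Sa: (a \in S).
    exists (cast_ord cardS (enum_rank_in Sa a)); left.
    by rewrite cast_ordK enum_rankK_in.
  have Sna : - a \in S by rewrite nS a0 Sa.
  exists (cast_ord cardS (enum_rank_in Sna (- a))); right.
  by rewrite cast_ordK enum_rankK_in ?opprK.
Qed.

End OddGroup.

(** * The inner group and the generalised dihedral group *)

Section InnerGroup.
Variable H : finZmodType.
Implicit Types (x y z : H) (g : {perm H}).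

Lemma rmultE x y : rmult x y = x *+ 2 - y. Proof. by rewrite permE. Qed.

Lemma rmult_Inn x : rmult x \in Inn H.
Proof. by apply/mem_gen/imsetP; exists x. Qed.

Lemma rmultM3 x y : (rmult 0 * rmult y * rmult x)%g = rmult (x - y).
Proof.
by apply/permP => z; rewrite !permM !rmultE mul0rn sub0r mulrnBl opprK opprD
  addrA.
Qed.

Lemma rmultJ x y : (rmult x * rmult y * rmult x)%g = rmult (x *+ 2 - y).
Proof.
apply/permP => z; rewrite !permM !rmultE mulrnBl opprB (mulr2n (x *+ 2)) !addrA.
by rewrite addrAC.
Qed.

(** The generators are involutions, so products of generators suffice:
    no inverses occur in the induction. *)
Lemma Inn_ind (P : {perm H} -> Prop) :
    P 1%g -> (forall g x, g \in Inn H -> P g -> P (g * rmult x)%g) ->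
  forall g, g \in Inn H -> P g.
Proof.
move=> P1 PM g /gen_prodgP[n [c Ac ->]].
suff: (\prod_(i < n) c i)%g \in Inn H /\ P (\prod_(i < n) c i)%g by case.
elim: n c Ac => [|n IHn] c Ac; first by rewrite big_ord0 group1.
rewrite big_ord_recr /=; have /imsetP[x _ ->] := Ac ord_max.
have [|Gg Pg] := IHn (fun i => c (widen_ord (leqnSn n) i)).
  by move=> i; apply: Ac.
by split; [rewrite groupM ?rmult_Inn | apply: PM].
Qed.

(** The element h s^b acts on T as the translation by 2h, followed by negation
    if b holds; the rotation h thus corresponds to [rmult 0] followed by
    [rmult h], and doubling is invertible in odd order. *)
Definition dih_perm (d : gdihedral H) : {perm H} :=
  (rmult 0%R * rmult d.1 * (if d.2 then rmult 0%R else 1))%g.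

Lemma dih_permE d x :
  dih_perm d x = (if d.2 then - (x + d.1 *+ 2) else x + d.1 *+ 2).
Proof.
rewrite /dih_perm !permM !rmultE mul0rn sub0r opprK [_ + x]addrC.
by case: d.2; rewrite ?perm1 ?rmultE ?mul0rn ?sub0r.
Qed.

Lemma dih_permM : {in [set: gdihedral H] &, {morph dih_perm : c d / (c * d)%g}}.
Proof.
move=> [a b] [c d] _ _; apply/permP => x; rewrite permM !dih_permE /=.
by case: b; case: d => /=;
  rewrite ?addbF ?addbT /= mulrnDl ?mulNrn ?opprD ?opprK ?addrA.
Qed.

Canonical dih_morphism := Morphism dih_permM.

(** The evaluations at 0 and at one nonzero point recover h and b from the
    permutation. The trivial group is excluded because negation is then the
    identity, whereas s is not. *)
Lemma Inn_isom_gdihedral : odd #|H| -> (1 < #|H|)%N ->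
  exists f : {morphism Inn H >-> gdihedral H},
    [/\ isom (Inn H) [set: gdihedral H] f, f (rmult 0%R) = dih_s H &
        forall h, f (rmult 0%R * rmult h)%g = dih_rot h].
Proof.
move=> oddH H_gt1.
have isoD : isom [set: gdihedral H] (Inn H) dih_morphism.
  apply/isomP; split.
    apply/injmP => -[a b] [c d] _ _ /= /permP eqp.
    have eq0 := eqp 0; rewrite !dih_permE /= !add0r in eq0.
    have bd : b = d.
      have [z z0] : exists z : H, z != 0.
        have /card_gt1P[y [z [_ _ yz]]] := H_gt1.
        case: (eqVneq y 0) yz => [-> z0|y0 _]; last by exists y.
        by exists z; rewrite eq_sym.
      have := eqp z; rewrite !dih_permE /=; case: (b) (d) eq0 => [] [] //= e.
        by rewrite opprD e => /addIr/eqP; rewrite eq_sym eq_opp0 // (negPf z0).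
      by rewrite opprD -e => /addIr/eqP; rewrite eq_opp0 // (negPf z0).
    rewrite bd in eq0 *; congr (_, _); apply: (mulr2n_inj oddH).
    by case: d {bd eqp} eq0 => // /oppr_inj.
  apply/eqP; rewrite eqEsubset; apply/andP; split.
    apply/subsetP => _ /morphimP[d _ _ ->]; rewrite /= /dih_perm.
    by case: d.2; rewrite ?mulg1 !groupM ?rmult_Inn.
  rewrite gen_subG; apply/subsetP => _ /imsetP[x _ ->].
  apply/morphimP; exists ((- x, true) : gdihedral H); rewrite ?inE //=.
  by rewrite /dih_perm /= rmultM3 sub0r opprK.
have Did d g : dih_perm d = g -> isom_inv isoD g = d.
  by move=> <-; apply: (invmE (isom_inj isoD)); rewrite inE.
exists (isom_inv isoD); split; first exact: isom_sym.
  apply: Did; rewrite /dih_perm /=; apply/permP=> x.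
  by rewrite !permM !rmultE !mul0rn !sub0r opprK.
by move=> h; apply: Did; rewrite /dih_perm /= mulg1.
Qed.

End InnerGroup.

(** * Right ideals as invariant subspaces *)

Section RightIdeals.
Variables (K : fieldType) (H : finZmodType).
Notation KH := (quandle_ring K H).
Notation perm_action := Defs.perm_action.
Implicit Types (u v : KH) (V J : {vspace KH}).

Lemma qbasis_expand u : u = \sum_x u x *: qbasis K x.
Proof.
apply/ffunP => y; rewrite sum_ffunE (bigD1 y) //= big1 => [|x xy].
  by rewrite !ffunE eqxx addr0 [_ *: _]mulr1.
by rewrite !ffunE eq_sym (negPf xy) scaler0.
Qed.

Lemma perm_actionE g u x : perm_action g u (g x) = u x.
Proof.
rewrite /perm_action sum_ffunE (bigD1 x) //= big1 => [|y yx].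
  by rewrite !ffunE eqxx addr0 /GRing.scale /= mulr1.
by rewrite !ffunE (inj_eq perm_inj) eq_sym (negPf yx) scaler0.
Qed.

Lemma qmul_perm_action u v :
  qmul (@takasaki H) u v = \sum_x v x *: perm_action (rmult x) u.
Proof.
rewrite /qmul exchange_big; apply: eq_bigr => y _; rewrite scaler_sumr.
by apply: eq_bigr => x _; rewrite scalerA [v y * _]mulrC permE.
Qed.

(** Multiplying on the right by a basis element x is the action of R_x. *)
Lemma right_idealP V :
  right_ideal (@takasaki H) V <->
  forall x u, u \in V -> perm_action (rmult x) u \in V.
Proof.
split=> [idV x u Vu | closedV u v Vu]; last first.
  by rewrite qmul_perm_action memv_suml // => x _; rewrite memvZ ?closedV.
have := idV u (qbasis K x) Vu; rewrite qmul_perm_action (bigD1 x) //= big1.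
  by rewrite addr0 ffunE eqxx scale1r.
by move=> y yx; rewrite ffunE (negPf yx) scale0r.
Qed.

Lemma right_ideal_Inn J : right_ideal (@takasaki H) J ->
  forall g, g \in Inn H -> forall u, u \in J -> perm_action g u \in J.
Proof.
move=> /right_idealP idJ; apply: Inn_ind => [u Ju | g x _ IHg u Ju].
  rewrite (_ : perm_action _ u = u) //; apply/ffunP => x.
  by rewrite -[in LHS](perm1 x) perm_actionE.
rewrite (_ : perm_action _ u = perm_action (rmult x) (perm_action g u)).
  by rewrite idJ ?IHg.
apply/ffunP => y; rewrite -(permKV (g * rmult x)%g y) perm_actionE.
by rewrite permM !perm_actionE.
Qed.

(** A nonzero right ideal inside V contains the image of a nonzero vector v,
    hence that of the submodule generated by v, which is everything. *)
Lemma equivalent_to_repr_simple V d (rG : mx_representation K (Inn H) d) :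
  mx_irreducible rG -> equivalent_to_repr V rG ->
  simple_right_ideal (@takasaki H) V.
Proof.
move=> /mx_irrP[d_gt0 irr] [f [/eqP ker_f <- fG]]; split.
- apply/right_idealP => x _ /memv_imgP[v _ ->].
  by rewrite -fG ?rmult_Inn // memv_img ?memvf.
- rewrite -dimv_eq0 limg_dim_eq ?(eqP ker_f) ?capv0 // dimvf.
  by rewrite /dim /= mul1n -lt0n.
move=> J idJ sJV; case: (eqVneq J 0%VS) => [->|J0]; [by left | right].
apply/eqP; rewrite eqEsubv sJV; apply/subvP => _ /memv_imgP[w _ ->].
have /memv_imgP[v _ fv] : vpick J \in limg f.
  by apply: (subvP sJV); apply: memv_pick.
have v0 : v != 0 by apply: contraNneq J0 => v0; rewrite -vpick0 fv v0 linear0.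
have /cyclic_mxP[A /envelop_mxP[a ->] ->] : (w <= cyclic_mx rG v)%MS.
  by rewrite submx_full // irr ?cyclic_mx_module ?cyclic_mx_eq0.
rewrite mulmx_sumr linear_sum memv_suml //= => g Gg.
rewrite -scalemxAr linearZ memvZ //= fG // right_ideal_Inn // -fv.
exact: memv_pick.
Qed.

Lemma equivalent_to_repr_rsim V d (rG rG' : mx_representation K (Inn H) d) :
  mx_rsim rG' rG -> equivalent_to_repr V rG -> equivalent_to_repr V rG'.
Proof.
case=> B _ freeB homB [f [/eqP ker_f im_f fG]].
have unitB : B \in unitmx by rewrite -row_free_unit.
exists (f \o linfun (mulmxr B))%VF; split.
- apply/eqP/lker0P => v w; rewrite !comp_lfunE !lfunE /=.
  by move/(lker0P ker_f); apply: row_free_inj.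
- rewrite -im_f; apply/eqP; rewrite eqEsubv; apply/andP; split.
    by apply/subvP => _ /memv_imgP[v _ ->]; rewrite comp_lfunE memv_img ?memvf.
  apply/subvP => _ /memv_imgP[v _ ->]; apply/memv_imgP.
  by exists (v *m invmx B); rewrite ?memvf // comp_lfunE lfunE /= mulmxKV.
by move=> g Gg v; rewrite !comp_lfunE !lfunE /= -fG // -!mulmxA homB.
Qed.

Lemma const_right_ideal :
  let V := <[\sum_x qbasis K x]>%VS in
  \dim V = 1%N /\ simple_right_ideal (@takasaki H) V.
Proof.
set s := \sum_x _; have sE x : s x = 1.
  rewrite sum_ffunE (bigD1 x) //= big1 => [|y yx];
    rewrite ffunE ?eqxx ?addr0 //.
  by rewrite eq_sym (negPf yx).
have s0 : s != 0 by apply/eqP => /ffunP/(_ 0)/eqP; rewrite sE ffunE oner_eq0.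
have dimV : \dim <[s]> = 1%N by rewrite dim_vline s0.
split=> //; split.
- apply/right_idealP => x u /vlineP[k ->]; apply/vlineP; exists k.
  apply/ffunP=> y; rewrite -[y](permKV (rmult x)) perm_actionE.
  by rewrite !ffunE !sE.
- by rewrite -dimv_eq0 dimV.
move=> J _ sJV; case: (eqVneq J 0%VS) => [|J0]; [by left | right].
by apply/eqP; rewrite eqEdim sJV dimV lt0n dimv_eq0.
Qed.

End RightIdeals.

(** * Degree-two representations on regular polygons *)

(** Schur's lemma for an intertwiner with an irreducible source: its kernel is
    a proper submodule. *)
Lemma irr_hom_rsim (K : fieldType) (gT : finGroupType) (G : {group gT}) n
    (rG1 rG2 : mx_representation K G n) (X : 'M_n) :
    mx_irreducible rG1 -> X != 0 ->
    {in G, forall g, rG1 g *m X = X *m rG2 g} ->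
  mx_rsim rG1 rG2.
Proof.
move=> /mx_irrP[_ irr] X0 homX; exists X => //; rewrite -kermx_eq0.
apply: contraNT X0 => /irr ker_full.
suff /ker_full: mxmodule rG1 (kermx X).
  by rewrite -sub1mx => /sub_kermxP; rewrite mul1mx => ->.
apply/mxmoduleP => g Gg; apply/sub_kermxP.
by rewrite -mulmxA homX // mulmxA mulmx_ker mul0mx.
Qed.

(** The functions [tcos a x] and [tsin a x] stand for the real and imaginary
    parts of a symmetric nondegenerate bicharacter of H at (a, x), but take
    their values in K. This is what allows K to be the real or the complex
    field. Nondegeneracy is expressed by the last field. *)
Record trig_pairing (K : fieldType) (H : finZmodType) := TrigPairing {
  tcos : H -> H -> K;
  tsin : H -> H -> K;
  tcosD a x y : tcos a (x + y) = tcos a x * tcos a y - tsin a x * tsin a y;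
  tsinD a x y : tsin a (x + y) = tsin a x * tcos a y + tcos a x * tsin a y;
  tcos0 a : tcos a 0 = 1;
  tcosN a x : tcos a (- x) = tcos a x;
  tsinN a x : tsin a (- x) = - tsin a x;
  tcosC a x : tcos a x = tcos x a;
  tsinC a x : tsin a x = tsin x a;
  tcos_sum a : a != 0 -> \sum_x tcos a x = 0
}.

Section Polygons.
Variables (K : fieldType) (H : finZmodType) (tp : trig_pairing K H).
Hypotheses (charK : [pchar K] =i pred0) (oddH : odd #|H|).
Implicit Types (a b x y : H) (g : {perm H}).
Notation KH := (quandle_ring K H).
Notation perm_action := Defs.perm_action.
Notation c := (tcos tp).
Notation s := (tsin tp).
Notation N := (#|H|%:R : K).

Let nat0 n : (n%:R == 0 :> K) = (n == 0)%N.
Proof. by have /pcharf0P := charK; apply. Qed.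

Let N0 : N != 0. Proof. by rewrite nat0 -lt0n; apply/card_gt0P; exists 0. Qed.

Let two0 : 2 != 0 :> K. Proof. by rewrite nat0. Qed.

Let eq_opp_eq0 (k : K) : k = - k -> k = 0.
Proof.
move/eqP; rewrite -addr_eq0 -mulr2n -mulr_natr mulf_eq0 (negPf two0) orbF.
by move/eqP.
Qed.

Lemma tcos2_sin2 a x : c a x ^+ 2 + s a x ^+ 2 = 1.
Proof.
by have := tcosD tp a x (- x); rewrite subrr tcos0 tcosN tsinN => ->; ring.
Qed.

Lemma tcosNl a x : c (- a) x = c a x.
Proof. by rewrite tcosC tcosN tcosC. Qed.

Lemma tsinNl a x : s (- a) x = - s a x.
Proof. by rewrite tsinC tsinN tsinC. Qed.

Lemma tcos_sumE a : \sum_x c a x = (a == 0)%:R * N.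
Proof.
case: eqVneq => [->|a0]; last by rewrite tcos_sum // mul0r.
by rewrite (eq_bigr (fun=> 1)) ?sumr_const ?mul1r // => x _;
  rewrite tcosC tcos0.
Qed.

Lemma tcos_orth a b :
  \sum_x c a x * c b x = ((a == b)%:R + (a == - b)%:R) * (N / 2).
Proof.
have cc x : c a x * c b x = (c (a - b) x + c (a + b) x) / 2.
  by rewrite !(tcosC _ _ x) !tcosD tcosN tsinN; field.
rewrite (eq_bigr _ (fun x _ => cc x)) -mulr_suml big_split /= !tcos_sumE.
by rewrite subr_eq0 addr_eq0; ring.
Qed.

Definition vertex a x : 'rV[K]_2 := \row_j (if j == 0 then c a x else s a x).

Definition dot n (v w : 'rV[K]_n) : K := (v *m w^T) 0 0.

Lemma dotE n (v w : 'rV[K]_n) : v *m w^T = (dot v w)%:M.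
Proof. exact: mx11_scalar. Qed.

Lemma dotC n (v w : 'rV[K]_n) : dot v w = dot w v.
Proof. by rewrite /dot -{1}[v]trmxK -trmx_mul mxE. Qed.

Lemma dot_vertex a x y : dot (vertex a x) (vertex a y) = c a (x - y).
Proof.
rewrite /dot !mxE !big_ord_recl big_ord0 !mxE /= addr0 tcosD tcosN tsinN.
ring.
Qed.

(** The right-hand side is the image of the vertex of y under the orthogonal
    reflection fixing the vertex of x. *)
Lemma vertex_reflection a x y :
  vertex a (x *+ 2 - y) =
  (2 * dot (vertex a y) (vertex a x)) *: vertex a x - vertex a y.
Proof.
rewrite dotC dot_vertex mulr2n -addrA.
rewrite (_ : vertex a y = vertex a (x - (x - y))); last by rewrite subKr.
move: (x - y) => z; apply/rowP => j; rewrite !mxE; case: ifP => _.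
  by rewrite !tcosD tcosN tsinN; ring.
by rewrite !tsinD tcosN tsinN; ring.
Qed.

(** The diagonal entries agree because cos and sin have the same mean square:
    this needs 2a <> 0, hence odd order. *)
Lemma vertex_frame a : a != 0 ->
  \sum_x (vertex a x)^T *m vertex a x = (N / 2)%:M.
Proof.
move=> a0; have cs0 : \sum_x c a x * s a x = 0.
  apply: eq_opp_eq0; rewrite {1}(reindex_inj oppr_inj) -sumrN.
  by apply: eq_bigr => x _; rewrite tcosN tsinN mulrN.
have cc : \sum_x c a x * c a x = N / 2.
  by rewrite tcos_orth eqxx eq_opp0 // (negPf a0) addr0 mul1r.
have ss : \sum_x s a x * s a x = N / 2.
  have: \sum_x (c a x * c a x + s a x * s a x) = N.
    rewrite (eq_bigr (fun=> 1)) ?sumr_const // => x _.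
    by rewrite -!expr2 tcos2_sin2.
  by rewrite big_split cc => /(canRL (addKr _)) ->; field.
apply/matrixP => i j; rewrite summxE.
under eq_bigr do rewrite mxE big_ord1 !mxE.
rewrite !mxE -!val_eqE; case: i j => [[|[|//]] ?] [[|[|//]] ?] //=.
by under eq_bigr do rewrite mulrC.
Qed.

Lemma vertex_expand a m (A : 'M[K]_(m, 2)) : a != 0 ->
  A = (2 / N) *: \sum_x A *m ((vertex a x)^T *m vertex a x).
Proof.
move=> a0; rewrite -mulmx_sumr vertex_frame // mul_mx_scalar scalerA.
have -> : 2 / N * (N / 2) = 1 by field; rewrite N0 two0.
by rewrite scale1r.
Qed.

(** By [vertex_expand], this is the only candidate for a linear map that moves
    the vertices as g moves their labels. *)
Definition polygon_mx a g : 'M[K]_2 :=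
  (2 / N) *: \sum_x (vertex a x)^T *m vertex a (g x).

Lemma polygon_mx_uniq a g A : a != 0 ->
  (forall x, vertex a x *m A = vertex a (g x)) -> polygon_mx a g = A.
Proof.
move=> a0 Ag; rewrite -[RHS]mul1mx [1%:M](vertex_expand _ a0).
rewrite -scalemxAl mulmx_suml.
by congr (_ *: _); apply: eq_bigr => x _; rewrite mul1mx -mulmxA Ag.
Qed.

Lemma reflection_mxE a x (v : 'rV_2) :
  v *m (2 *: ((vertex a x)^T *m vertex a x) - 1%:M) =
  (2 * dot v (vertex a x)) *: vertex a x - v.
Proof.
by rewrite mulmxBr mulmx1 -scalemxAr mulmxA dotE mul_scalar_mx scalerA.
Qed.

Lemma vertex_polygon_mx a g : a != 0 -> g \in Inn H ->
  forall x, vertex a x *m polygon_mx a g = vertex a (g x).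
Proof.
move=> a0 Gg.
suff [A Ag] : exists A, forall x, vertex a x *m A = vertex a (g x).
  by move=> x; rewrite (polygon_mx_uniq a0 Ag).
move: g Gg; apply: Inn_ind => [|g z _ [A Ag]].
  by exists 1%:M => x; rewrite mulmx1 perm1.
exists (A *m (2 *: ((vertex a z)^T *m vertex a z) - 1%:M)) => x.
by rewrite mulmxA Ag reflection_mxE permM rmultE vertex_reflection.
Qed.

Lemma polygon_mx_rmult a x : a != 0 ->
  polygon_mx a (rmult x) = 2 *: ((vertex a x)^T *m vertex a x) - 1%:M.
Proof.
move=> a0; apply: polygon_mx_uniq => // y.
by rewrite reflection_mxE rmultE vertex_reflection.
Qed.

Lemma polygon_repr a : a != 0 -> mx_repr (Inn H) (polygon_mx a).
Proof.
move=> a0; split; first by apply: polygon_mx_uniq => // x; rewrite mulmx1 perm1.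
move=> g h Gg Gh; apply: polygon_mx_uniq => // x.
by rewrite mulmxA !vertex_polygon_mx // permM.
Qed.

Definition psi a (a0 : a != 0) := MxRepresentation (polygon_repr a0).

(** The matrices are orthogonal: the transpose is the inverse. *)
Lemma polygon_mxV a g : polygon_mx a g^-1 = (polygon_mx a g)^T.
Proof.
rewrite /polygon_mx linearZ /= [(\sum__ _)^T]raddf_sum; congr (_ *: _).
rewrite (reindex_inj (@perm_inj _ g)); apply: eq_bigr => x _.
by rewrite permK /= trmx_mul trmxK.
Qed.

(** Any two labels have a midpoint, whose reflection exchanges them; so all the
    vertices lie in W, and they span the plane. *)
Lemma mem_vertex_full a (a0 : a != 0) m (W : 'M_(m, 2)) x :
  mxmodule (psi a0) W -> (vertex a x <= W)%MS -> row_full W.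
Proof.
move=> modW Wx; rewrite -sub1mx [1%:M](vertex_expand _ a0) scalemx_sub //.
apply: summx_sub => y _; rewrite mulmxA (submx_trans (submxMl _ _)) //.
have -> : vertex a y = vertex a x *m psi a0 (rmult (halve (x + y))).
  by rewrite /= vertex_polygon_mx ?rmult_Inn // rmultE halveK // addrC addKr.
by apply: mxmodule_trans; rewrite ?rmult_Inn.
Qed.

(** If w lies in a submodule, so does w + w psi_a(R_x), which is a multiple of
    u_a(x); it is nonzero unless w is orthogonal to u_a(x). *)
Lemma psi_irr a (a0 : a != 0) : mx_irreducible (psi a0).
Proof.
apply/mx_irrP; split=> // W modW /rowV0Pn[w Ww w0].
have [x wx] : exists x, dot w (vertex a x) != 0.
  apply/existsP; apply: contraNT w0; rewrite negb_exists => /forallP w_orth.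
  rewrite [w](vertex_expand _ a0) big1 ?scaler0 // => x _.
  have := w_orth x; rewrite negbK mulmxA dotE => /eqP->.
  by rewrite mul_scalar_mx scale0r.
apply: (mem_vertex_full (x := x) modW).
have : ((w *m psi a0 (rmult x) + w)%R <= W)%MS.
  by rewrite addmx_sub // mxmodule_trans ?rmult_Inn.
rewrite /= polygon_mx_rmult // reflection_mxE subrK.
move/(scalemx_sub (2 * dot w (vertex a x))^-1).
by rewrite scalerA mulVf ?scale1r // mulf_eq0 negb_or two0.
Qed.

(** The permutation is the translation by 2h, that is, a rotation of the
    polygon. *)
Lemma polygon_mx_trace a h : a != 0 ->
  \tr (polygon_mx a (rmult 0%R * rmult h)%g) = 2 * c a (h *+ 2).
Proof.
move=> a0; rewrite linearZ linear_sum /=.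
rewrite (eq_bigr (fun=> c a (h *+ 2))) => [|x _].
  by rewrite sumr_const -[RHS]mul1r -mulr_natr; field.
rewrite mxtrace_mulC dotE mxtrace_scalar mulr1n dot_vertex.
by rewrite permM !rmultE mul0rn sub0r opprK addrK.
Qed.

(** The traces of rotations determine cos <a, x> for all x, hence a up to sign
    by orthogonality. *)
Lemma psi_inj a b (a0 : a != 0) (b0 : b != 0) :
  mx_rsim (psi a0) (psi b0) -> a = b \/ a = - b.
Proof.
move=> sim; have cab x : c a x = c b x.
  have := mxtrace_rsim sim (groupM (rmult_Inn 0%R) (rmult_Inn (halve x))).
  by rewrite /= !polygon_mx_trace // halveK // => /(mulfI two0).
have : \sum_x c a x * c b x != 0.
  rewrite (eq_bigr (fun x => c a x * c a x)) => [|x _]; last by rewrite cab.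
  rewrite tcos_orth eqxx eq_opp0 // (negPf a0) addr0 mul1r.
  by rewrite mulf_eq0 invr_eq0 negb_or N0.
rewrite tcos_orth; case: (a =P b) => [|_]; first by left.
by case: (a =P - b) => [|_]; [right | rewrite addr0 mul0r eqxx].
Qed.

(** The polygon of - a is the mirror image of the polygon of a in the first
    axis. *)
Lemma psi_opp a b (a0 : a != 0) (b0 : b != 0) :
  - a = b -> mx_rsim (psi a0) (psi b0).
Proof.
move=> ab; pose D : 'M[K]_2 := diag_mx (\row_j (if j == 0 then 1 else -1)).
have vD x : vertex a x *m D = vertex b x.
  apply/rowP => j; rewrite mul_mx_diag !mxE -ab.
  by case: ifP => _; rewrite ?mulr1 ?mulrN1 ?tcosNl ?tsinNl.
have DD : D *m D = 1%:M.
  rewrite mulmx_diag; apply/matrixP => i j; rewrite !mxE; congr (_ *+ _).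
  by case: ifP; rewrite ?mulr1 ?mulrNN ?mulr1.
exists D => // [|g Gg].
  by rewrite row_free_unit; have [] := mulmx1_unit DD.
rewrite /= (_ : polygon_mx b g = D *m polygon_mx a g *m D).
  by rewrite !mulmxA DD mul1mx.
apply: polygon_mx_uniq => // x.
by rewrite -vD !mulmxA -(mulmxA _ D D) DD mulmx1 vertex_polygon_mx // vD.
Qed.

(** * The components of the quandle ring *)

Definition vertex_fun a (v : 'rV[K]_2) : KH := [ffun x => dot v (vertex a x)].

Lemma vertex_fun_is_linear a : linear (vertex_fun a).
Proof.
move=> k v w; apply/ffunP => x; rewrite !ffunE /dot mulmxDl -scalemxAl.
by rewrite mxE [X in X + _]mxE.
Qed.

HB.instance Definition _ a :=
  GRing.isLinear.Build K 'rV[K]_2 KH _ (vertex_fun a) (vertex_fun_is_linear a).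

Definition Vcomp a : {vspace KH} := limg (linfun (vertex_fun a)).

Lemma vertex_fun_Vcomp a v : vertex_fun a v \in Vcomp a.
Proof. by rewrite -lfunE memv_img ?memvf. Qed.

Lemma vertex_fun_ker a : a != 0 -> lker (linfun (vertex_fun a)) = 0%VS.
Proof.
move=> a0; apply/eqP; rewrite -subv0; apply/subvP => v.
rewrite memv_ker lfunE memv0 /= => /eqP/ffunP v0.
rewrite [v](vertex_expand _ a0) big1 ?scaler0 // => x _.
have := v0 x; rewrite !ffunE mulmxA dotE => ->.
by rewrite mul_scalar_mx scale0r.
Qed.

Lemma dim_Vcomp a : a != 0 -> \dim (Vcomp a) = 2%N.
Proof.
move=> a0; rewrite limg_dim_eq ?vertex_fun_ker ?capv0 // dimvf.
by rewrite /dim /= mul1n.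
Qed.

Lemma Vcomp_equiv a (a0 : a != 0) : equivalent_to_repr (Vcomp a) (psi a0).
Proof.
exists (linfun (vertex_fun a)); split=> [||g Gg v]; rewrite ?vertex_fun_ker //.
rewrite !lfunE /=; apply/ffunP => x; rewrite -[x](permKV g) perm_actionE !ffunE.
rewrite /dot -mulmxA -{1}[polygon_mx a g]trmxK -polygon_mxV -trmx_mul.
by rewrite vertex_polygon_mx ?groupV // permK.
Qed.

Lemma vertex_fun_vertex a x :
  vertex_fun a (vertex a x) = [ffun y => c a (x - y)].
Proof. by apply/ffunP => y; rewrite !ffunE dot_vertex. Qed.

Lemma vertex_inversion x y :
  \sum_a dot (vertex a x) (vertex a y) = (x == y)%:R * N.
Proof.
under eq_bigr do rewrite dot_vertex tcosC.
by rewrite tcos_sumE subr_eq0.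
Qed.

Lemma qbasis_inversion x :
  qbasis K x = N^-1 *: \sum_a vertex_fun a (vertex a x).
Proof.
apply: (canRL (scalerK N0)); apply/ffunP => y; rewrite sum_ffunE !ffunE eq_sym.
by under [RHS]eq_bigr do rewrite ffunE; rewrite vertex_inversion [_ *: _]mulrC.
Qed.

(** * Completeness of the list of representations *)

Lemma irr_stable_line (rG : mx_representation K (Inn H) 2) (v : 'rV_2) :
    mx_irreducible rG -> (forall x, v *m rG (rmult x) <= v)%MS -> v = 0.
Proof.
move=> /mx_irrP[_ irr] stable_v; apply/eqP/negPn/negP => v0.
suff: row_full (<<v>>%MS).
  by rewrite /row_full genmxE rank_rV v0.
apply: irr; last by rewrite -submx0 genmxE submx0.
rewrite /mxmodule gen_subG; apply/subsetP => _ /imsetP[x _ ->].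
by rewrite inE rmult_Inn (eqmxMr _ (genmxE _)) genmxE stable_v.
Qed.

(** The intertwiner is the sum of u_a(x)^T w(x) for an equivariant family w.
    By Fourier inversion it cannot vanish for all a <> 0 unless w is constant,
    that is, unless rho has an invariant line. *)
Lemma psi_complete (rG : mx_representation K (Inn H) 2) :
  mx_irreducible rG -> exists a, exists a0 : a != 0, mx_rsim rG (psi a0).
Proof.
move=> irrG; pose r x := rG (rmult x).
have rr x : r x *m r x = 1%:M.
  rewrite -repr_mxM ?rmult_Inn // -(repr_mx1 rG); congr (rG _).
  by apply/permP => y; rewrite permM !rmultE subKr perm1.
(* A fixed vector of R_0 exists: if R_0 acted as -1, so would all its
   conjugates R_x, and every line would be invariant. *)
have [v v_fix] : exists v : 'rV_2, v *m (1%:M + r 0) != 0.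
  have [i ri] : exists i, row i (1%:M + r 0) != 0; last first.
    by exists (delta_mx 0 i); rewrite -rowE.
  apply/existsP; apply: contraT => /existsPn rows0.
  have rN : 1%:M + r 0 = 0.
    apply/row_matrixP => i; rewrite row0; apply/eqP.
    by have := rows0 i; rewrite negbK.
  have {rN} rN u : u *m r 0 = - u.
    by apply/eqP; rewrite -addr_eq0 addrC -{1}[u]mulmx1 -mulmxDr rN mulmx0.
  have /matrixP/(_ 0 0) : delta_mx 0 0 = 0 :> 'rV[K]_2.
    apply: (irr_stable_line irrG) => x.
    have -> : rmult x = (rmult (halve x) * rmult 0%R * rmult (halve x))%g.
      by rewrite rmultJ halveK // subr0.
    rewrite !repr_mxM ?groupM ?rmult_Inn // -/(r _) !mulmxA rN mulNmx.
    by rewrite -mulmxA rr mulmx1 eqmx_opp.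
  by rewrite !mxE /= => /eqP; rewrite oner_eq0.
(* R_(x/2) maps 0 to x, so the x-th vector is the translate of the 0-th. *)
pose w x := v *m (1%:M + r 0) *m r (halve x).
have wr x y : w y *m r x = w (x *+ 2 - y).
  have v0 : v *m (1%:M + r 0) *m r 0 = v *m (1%:M + r 0).
    by rewrite -mulmxA mulmxDl mul1mx rr addrC.
  have -> : w (x *+ 2 - y) = v *m (1%:M + r 0) *m r (x - halve y).
    congr (_ *m r _); apply: (mulr2n_inj oddH).
    by rewrite mulrnBl !halveK.
  rewrite /w -{1}v0 -!(mulmxA (v *m _)); congr (_ *m _).
  by rewrite -!repr_mxM ?groupM ?rmult_Inn // rmultM3.
have wG g : g \in Inn H -> forall x, w x *m rG g = w (g x).
  move: g; apply: Inn_ind => [x|g z Gg IHg x].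
    by rewrite repr_mx1 mulmx1 perm1.
  by rewrite repr_mxM ?rmult_Inn // mulmxA IHg permM rmultE -wr.
pose X a := \sum_x (vertex a x)^T *m w x.
have homX a (a0 : a != 0) : {in Inn H, forall g, psi a0 g *m X a = X a *m rG g}.
  move=> g Gg; rewrite mulmx_sumr mulmx_suml (reindex_inj (@perm_inj _ g)).
  apply: eq_bigr => x _; rewrite -[RHS]mulmxA wG // mulmxA; congr (_ *m _).
  apply: trmx_inj; rewrite trmx_mul !trmxK /= -polygon_mxV.
  by rewrite vertex_polygon_mx ?groupV // permK.
have [/existsP[a /andP[a0 Xa]] | /existsPn X_eq0]
  := boolP [exists a, (a != 0) && (X a != 0)].
  exists a, a0; apply: mx_rsim_sym; apply: irr_hom_rsim Xa (homX a a0).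
  exact: psi_irr.
have w_const y : w y = N^-1 *: \sum_x w x.
  apply: (canRL (scalerK N0)).
  have -> : N *: w y = \sum_x (\sum_a dot (vertex a y) (vertex a x)) *: w x.
    rewrite (bigD1 y) //= vertex_inversion eqxx mul1r big1 ?addr0 // => x xy.
    by rewrite vertex_inversion eq_sym (negPf xy) mul0r scale0r.
  under eq_bigr do rewrite scaler_suml.
  rewrite exchange_big (bigD1 0) //= [X in _ + X]big1 ?addr0 => [|a a0].
    by apply: eq_bigr => x _; rewrite dot_vertex tcosC tcos0 scale1r.
  have := X_eq0 a; rewrite a0 negbK => /eqP/(congr1 (mulmx (vertex a y))).
  rewrite mulmx0 mulmx_sumr => X0; rewrite -[RHS]X0; apply: eq_bigr => x _.
  by rewrite mulmxA dotE mul_scalar_mx.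
have w0 : w 0 = 0.
  apply: (irr_stable_line irrG) => x.
  by rewrite [rG _]/(r x) wr !w_const.
case/negP: v_fix; apply/eqP; move/(congr1 (mulmx^~ (r (halve 0)))): w0.
by rewrite /w -mulmxA rr mulmx1 mul0mx.
Qed.

(** * The decomposition *)

Lemma card_odd_pairs : (1 + \sum_(j < (#|H| - 1) %/ 2) 2)%N = #|H|.
Proof.
have H_gt0 : (0 < #|H|)%N by apply/card_gt0P; exists 0.
rewrite sum_nat_const card_ord divnK ?add1n ?subn1 ?prednK //.
by rewrite dvdn2 -subn1 oddB // oddH.
Qed.

Section Decomposition.
Notation m := ((#|H| - 1) %/ 2)%N.
Variable A : 'I_m -> H.
Hypothesis A0 : forall j, A j != 0.
Hypothesis A_inj : forall i j, A i = A j \/ A i = - A j -> i = j.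
Hypothesis A_surj : forall a, a != 0 -> exists j, a = A j \/ a = - A j.

Let Psi j := psi (A0 j).
Let Vtriv : {vspace KH} := <[\sum_x qbasis K x]>%VS.

Lemma Psi_complete_irr : complete_irr_family Psi.
Proof.
split=> [j | i j /psi_inj/A_inj // | rG irrG]; first exact: psi_irr.
have [a [a0 sim]] := psi_complete irrG; have [j aj] := A_surj a0.
exists j; apply: mx_rsim_trans sim _; case: aj => aj.
  move: a0; rewrite aj => a0; rewrite (eq_irrelevance a0 (A0 j)).
  exact: mx_rsim_refl.
by apply: psi_opp; rewrite aj opprK.
Qed.

(** In the expansion of a basis element x over a, the term of index a depends
    on a only up to sign, and the term of index 0 is constant. *)
Lemma Vcomp_span : (Vtriv + \sum_j Vcomp (A j))%VS = fullv.
Proof.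
apply/eqP; rewrite eqEsubv subvf; apply/subvP => u _.
rewrite [u]qbasis_expand memv_suml // => x _; rewrite memvZ //.
rewrite qbasis_inversion memvZ // memv_suml // => a _.
have inV j : (Vcomp (A j) <= Vtriv + \sum_j Vcomp (A j))%VS.
  by rewrite (subv_trans _ (addvSr _ _)) // (sumv_sup j).
case: (eqVneq a 0) => [->|a0].
  apply: (subvP (addvSl _ _)); apply/vlineP; exists 1; rewrite scale1r.
  rewrite vertex_fun_vertex; apply/ffunP => y.
  rewrite ffunE tcosC tcos0 sum_ffunE (bigD1 y) //= big1.
    by rewrite ffunE eqxx addr0.
  by move=> t ty; rewrite ffunE eq_sym (negPf ty).
have [j aj] := A_surj a0; apply: (subvP (inV j)).
rewrite (_ : vertex_fun a _ = vertex_fun (A j) (vertex (A j) x)).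
  exact: vertex_fun_Vcomp.
rewrite !vertex_fun_vertex; apply/ffunP => y; rewrite !ffunE.
by case: aj => ->; rewrite ?tcosNl.
Qed.

Lemma Vcomp_direct : directv (Vtriv + \sum_j Vcomp (A j)).
Proof.
rewrite directvE /= Vcomp_span dimvf.
rewrite (eq_bigr (fun=> 2%N)) => [|j _]; last exact: dim_Vcomp.
have [-> _] := const_right_ideal K H.
by rewrite card_odd_pairs /dim /= muln1.
Qed.

End Decomposition.

(** An arbitrary complete family is, up to equivalence, a reindexing of the
    family of the polygons: inequivalence makes the index map injective, hence
    a permutation. *)
Theorem quandle_ring_decomposition :
  let m := ((#|H| - 1) %/ 2)%N in
  let Vtriv : {vspace KH} := <[\sum_x qbasis K x]>%VS in
  (exists psi : 'I_m -> mx_representation K (Inn H) 2, complete_irr_family psi)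
  /\ forall psi : 'I_m -> mx_representation K (Inn H) 2,
       complete_irr_family psi ->
       exists V : 'I_m -> {vspace KH},
         [/\ (Vtriv + \sum_(j < m) V j)%VS = fullv,
             directv (Vtriv + \sum_(j < m) V j),
             forall j, simple_right_ideal (@takasaki H) (V j) &
             forall j, equivalent_to_repr (V j) (psi j)].
Proof.
move=> m Vtriv; have [A [A0 A_inj A_surj]] := half_system oddH.
have complA := Psi_complete_irr A0 A_inj A_surj.
split; first by exists (fun j => psi (A0 j)).
move=> phi [irr_phi inj_phi _]; have [_ _ surjA] := complA.
have [p sim_p] := fin_all_exists (fun j => surjA _ (irr_phi j)).
have inj_p : injective p.
  move=> i j pij; apply: inj_phi; apply: mx_rsim_trans (sim_p i) _.
  by rewrite pij; apply/mx_rsim_sym.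
have equivV j : equivalent_to_repr (Vcomp (A (p j))) (phi j).
  exact: equivalent_to_repr_rsim (sim_p j) (Vcomp_equiv (A0 (p j))).
have reindexV : (\sum_j Vcomp (A (p j)) = \sum_j Vcomp (A j))%VS.
  by rewrite [RHS](reindex_inj inj_p).
exists (fun j => Vcomp (A (p j))); split => // [||j].
- by rewrite reindexV Vcomp_span.
- have := Vcomp_direct A0 A_surj; rewrite !directvE /= reindexV => /eqP->.
  by apply/eqP; congr (_ + _)%N; rewrite [LHS](reindex_inj inj_p).
exact: equivalent_to_repr_simple (irr_phi j) (equivV j).
Qed.

End Polygons.

(** * Existence of the pairing on a product of cyclic groups *)

Lemma closed_prim_root (F : closedFieldType) n :
  [pchar F] =i pred0 -> (0 < n)%N ->
  exists z : F, n.-primitive_root z.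
Proof.
move=> /pcharf0P F0 n_gt0; pose p : {poly F} := 'X^n - 1.
have [r Dp] := closed_field_poly_normal p.
rewrite (monicP _) ?monicXnsubC // scale1r in Dp.
have rn1 : all n.-unity_root r by apply/allP=> z; rewrite -root_prod_XsubC -Dp.
have sz_r : (n < (size r).+1)%N.
  by rewrite -(size_prod_XsubC r id) -Dp size_XnsubC.
have [|z] := hasP (has_prim_root n_gt0 rn1 _ sz_r); last by exists z.
by rewrite -separable_prod_XsubC -Dp separable_Xn_sub_1 // F0 -lt0n.
Qed.

Section Existence.
Variables (R : rcfType) (k : nat) (n : 'I_k -> nat).
Notation H := (prodZ n).
Notation q i := (n i).-1.+1.
Variable z : 'I_k -> R[i].
Hypothesis prim_z : forall i, (q i).-primitive_root (z i).
Implicit Types a x : H.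

(** The product over i of z_i ^ (a_i x_i), well defined on residues because
    z_i is a root of unity of the right order. *)
Definition bichar a x : R[i] := \prod_i z i ^+ (a i * x i).

Lemma bicharC a x : bichar a x = bichar x a.
Proof. by apply: eq_bigr => i _; rewrite mulnC. Qed.

Lemma bicharD a x y : bichar a (x + y) = bichar a x * bichar a y.
Proof.
rewrite /bichar -big_split; apply: eq_bigr => i _ /=.
rewrite ffunE !exprM -exprD /= expr_mod //.
by rewrite -exprM mulnC exprM (prim_expr_order (prim_z i)) expr1n.
Qed.

Lemma bichar0 a : bichar a 0 = 1.
Proof. by rewrite /bichar big1 // => i _; rewrite ffunE muln0. Qed.

Lemma norm_bichar a x : `|bichar a x| = 1.
Proof.
rewrite normr_prod big1 // => i _; rewrite normrX.
suff -> : `|z i| = 1 by rewrite expr1n.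
apply/eqP; rewrite -(@pexpr_eq1 _ _ (q i)) //.
by rewrite -normrX (prim_expr_order (prim_z i)) normr1.
Qed.

Lemma bicharN a x : bichar a (- x) = (bichar a x)^*%C.
Proof.
have norm1 : bichar a x * (bichar a x)^*%C = 1.
  have := add_Re2_Im2 (bichar a x); rewrite norm_bichar expr1n => <-.
  case: (bichar a x) => u v; apply/eqP; rewrite eq_complex /=.
  by apply/andP; split; apply/eqP; ring.
by rewrite -[LHS]mulr1 -norm1 mulrA -bicharD addNr bichar0 mul1r.
Qed.

(** Nondegeneracy: if a_i <> 0, the character of a is nontrivial at e_i, and
    translating by e_i multiplies the sum by a factor different from 1. *)
Lemma bichar_sum a : a != 0 -> \sum_x bichar a x = 0.
Proof.
move=> a0; have [i ai0] : exists i, a i != 0.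
  apply/existsP; apply: contraNT a0 => /existsPn a0; apply/eqP/ffunP => i.
  by rewrite ffunE; apply/eqP; have := a0 i; rewrite negbK.
have e1 : bichar a (prodZ_e n i) != 1.
  rewrite /bichar (bigD1 i) //= big1 => [|j ji].
    have lt_ai := ltn_ord (a i); have ai_gt0 : (0 < a i)%N by rewrite lt0n.
    rewrite ffunE eqxx /= modn_small ?muln1 ?mulr1;
      last exact: leq_ltn_trans lt_ai.
    by rewrite -(prim_order_dvd (prim_z i)) gtnNdvd.
  by rewrite ffunE (negPf ji) muln0.
apply/eqP; have : (1 - bichar a (prodZ_e n i)) * \sum_x bichar a x == 0.
  rewrite mulrBl mul1r mulr_sumr.
  rewrite [X in X - _](reindex_inj (addrI (prodZ_e n i))).
  by rewrite subr_eq0; apply/eqP/eq_bigr => x _; rewrite bicharD.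
by rewrite mulf_eq0 subr_eq0 eq_sym (negPf e1).
Qed.

Variables (K : fieldType) (iota : {rmorphism R -> K}).

Lemma bichar_trig : trig_pairing K H.
Proof.
exists (fun a x => iota (complex.Re (bichar a x)))
       (fun a x => iota (complex.Im (bichar a x))) =>
         [a x y|a x y|a|a x|a x|a x|a x|a a0].
- rewrite bicharD -!rmorphM -rmorphB.
  by case: (bichar a x) (bichar a y) => [? ?] [? ?].
- rewrite bicharD -!rmorphM -rmorphD.
  by case: (bichar a x) (bichar a y) => [? ?] [? ?] /=; rewrite addrC.
- by rewrite bichar0 rmorph1.
- by rewrite bicharN; case: (bichar a x).
- by rewrite bicharN -rmorphN; case: (bichar a x).
- by rewrite bicharC.
- by rewrite bicharC.
have ReD : {morph @complex.Re R : u v / u + v} by move=> [? ?] [? ?].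
have Re0 : complex.Re (0 : R[i]) = 0 by [].
by rewrite -rmorph_sum -(big_morph _ ReD Re0) bichar_sum // rmorph0.
Qed.

End Existence.

Lemma trig_pairing_exists (R : rcfType) (K : fieldType)
    (iota : {rmorphism R -> K}) k (n : 'I_k -> nat) :
  inhabited (trig_pairing K (prodZ n)).
Proof.
have charC : [pchar R[i]] =i pred0 := pchar_num _.
have [z prim_z] := fin_all_exists
  (fun i => closed_prim_root charC (ltn0Sn (n i).-1)).
exact: inhabits (bichar_trig prim_z iota).
Qed.

Lemma card_prodZ k (n : 'I_k -> nat) :
  #|(prodZ n : finType)| = (\prod_i (n i).-1.+1)%N.
Proof.
rewrite card_dep_ffun foldrE big_map big_enum /=.
by apply: eq_bigr => i _; rewrite card_ord.
Qed.

Theorem theorem6p3 (R : realType) (K : fieldType)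
    (hK : K = (R : fieldType) \/ K = (R[i]%C : fieldType))
    (k : nat) (n : 'I_k -> nat) (hn : forall i, gcdn (n i) 2 = 1%N) :
  let H : finZmodType := prodZ n in
  let m := ((#|H| - 1) %/ 2)%N in
  let Vtriv : {vspace quandle_ring K H} := <[\sum_(x : H) qbasis K x]>%VS in
  [/\ (* Inn(T) is Dih(H); for |H| = 1 the former is trivial *)
      (1 < #|H|)%N ->
        exists f : {morphism Inn H >-> gdihedral H},
          [/\ isom (Inn H) [set: gdihedral H] f,
              f (rmult (0 : H)) = dih_s H &
              forall i : 'I_k,
                f (rmult (0 : H) * rmult (prodZ_e n i : H))%g
                  = dih_rot (prodZ_e n i : H)],
      exists psi : 'I_m -> mx_representation K (Inn H) 2,
        complete_irr_family psi &
      forall psi : 'I_m -> mx_representation K (Inn H) 2,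
        complete_irr_family psi ->
        exists V : 'I_m -> {vspace quandle_ring K H},
          [/\ (Vtriv + \sum_(j < m) V j)%VS = fullv,
              directv (Vtriv + \sum_(j < m) V j),
              \dim Vtriv = 1%N /\ simple_right_ideal (@takasaki H) Vtriv,
              forall j, simple_right_ideal (@takasaki H) (V j) &
              forall j, equivalent_to_repr (V j) (psi j)]].
Proof.
move=> H m Vtriv.
have oddH : odd #|H|.
  rewrite card_prodZ; apply: (big_ind odd) => // [a b|i _].
    by rewrite oddM => -> ->.
  have : coprime (n i) 2 by apply/eqP/hn.
  by rewrite coprimen2; case: (n i).
have [charK [tp]] : [pchar K] =i pred0 /\ inhabited (trig_pairing K H).
  case: hK => ->; split; try exact: pchar_num.
    exact: (trig_pairing_exists (GRing.RMorphism.clone _ _ (@idfun R) _)).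
  exact: (trig_pairing_exists (GRing.RMorphism.clone _ _ (real_complex R) _)).
have [exist_psi decomp] := quandle_ring_decomposition tp charK oddH.
split=> [H_gt1||phi /decomp[V [spanV dirV simV eqV]]] //.
  have [f [isof f0 fr]] := Inn_isom_gdihedral oddH H_gt1.
  by exists f; split=> // i; rewrite fr.
by exists V; split=> //; apply: const_right_ideal.
Qed.
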